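(* Let $n\ge 4$, $\mathfrak g=\mathfrak{so}(2n,\mathbb C)$, and let $\lambda=(\lambda_1,\dots,\lambda_n)\in\mathbb C^n$. Let $(\Phi_{\lambda,a^{(0)},b^{(0)}},V)$ be the specialized Schnizer module of $U_\varepsilon(\mathfrak{so}(2n,\mathbb C))$ defined in the context. Then a vector $u\in V$ satisfies $e_iu=0$ for all $i\in\{1,\dots,n\}$ if and only if $u\in\mathbb C\,u(0)$, where $u(0)=u(0,\dots,0)\in V$ is the basis vector with all indices equal to $0$.
   Context: **Quantum algebra.** $l>3$ is an odd integer, $\varepsilon\in\mathbb C$ a primitive $l$-th root of unity, $I=\{1,\dots,n\}$, $(a_{ij})$ is the Cartan matrix of $\mathfrak{so}(2n,\mathbb C)$ (type $D_n$, with nodes $n-1$ and $n$ both joined to node $n-2$), $d_i=1$ for all $i$, $[k]_{\varepsilon}=\frac{\varepsilon^k-\varepsilon^{-k}}{\varepsilon-\varepsilon^{-1}}$, $[k]_{\varepsilon}!=[k]_{\varepsilon}\cdots[1]_{\varepsilon}$. $U_\varepsilon=U_\varepsilon(\mathfrak g)$ is the associative $\mathbb C$-algebra with generators $e_i,f_i,t_i^{\pm1}$ ($i\in I$) and relations $t_it_i^{-1}=t_i^{-1}t_i=1$, $t_it_j=t_jt_i$, $t_ie_jt_i^{-1}=\varepsilon^{a_{ij}}e_j$, $t_if_jt_i^{-1}=\varepsilon^{-a_{ij}}f_j$, $e_if_j-f_je_i=\delta_{ij}\frac{t_i-t_i^{-1}}{\varepsilon-\varepsilon^{-1}}$, and for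 $i\ne j$, $\sum_{k=0}^{1-a_{ij}}(-1)^ke_i^{(k)}e_je_i^{(1-a_{ij}-k)}=0=\sum_{k=0}^{1-a_{ij}}(-1)^kf_i^{(k)}f_jf_i^{(1-a_{ij}-k)}$, where $e_i^{(k)}=e_i^k/[k]_{\varepsilon}!$, $f_i^{(k)}=f_i^k/[k]_{\varepsilon}!$. **The space $V$ and operators.** $V=(\mathbb C^l)^{\otimes n(n-1)}$ has basis $u(m)$, $m=(m_{ij})_{1\le i\le n-1,\,1\le j\le n}$, $0\le m_{ij}\le l-1$; indices $m_{ij}$ are read modulo $l$. Put $b_{ij}=1-i+j$ for $i\le j\le n-1$, $b_{in}=n-i$ for $1\le i\le n-1$, and $b_{ij}=2n-i-j$ for $j<i\le n-1$. Let $\epsilon_{ij}$ be the unit index vector at $(i,j)$. Define invertible operators $x_{i,j}u(m)=u(m-\epsilon_{ij})$ and $z_{i,j}u(m)=\varepsilon^{m_{ij}+b_{ij}}u(m)$ (this is the specialization $a^{(0)}=(1)_{i,j}$, $b^{(0)}=(\varepsilon^{b_{ij}})_{i,j}$ of the parameters). For an invertible operator $h$ put $\{h\}=\frac{h-h^{-1}}{\varepsilon-\varepsilon^{-1}}$. For $c\in\mathbb C$, $\varepsilon^c=\exp(c\log\varepsilon)$ for a fixed choice of $\log\varepsilon$. Empty products are $1$, empty sums are $0$. **The module (Schnizer).** Let $\sigma(k)=n-1$, $\tau(k)=n$ for $k$ odd, and $\sigma(k)=n$, $\tau(k)=n-1$ for $k$ even. The following operators define a $U_\varepsilon$-module structure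 $\Phi_{\lambda,a^{(0)},b^{(0)}}$ on $V$: $e_1=F_{1,1}$; $e_j=(\prod_{k=1}^{j-1}D_{k,j})F_{j,j}+\sum_{q=1}^{j-1}(\prod_{p=1}^{q-1}D_{p,j})C_{q,j}$ ($2\le j\le n-2$); $e_{n-1}=(\prod_{k=1}^{n-2}D_{k,\sigma(k)})F_{n-1,\sigma(n-1)}+\sum_{q=1}^{n-2}(\prod_{p=1}^{q-1}D_{p,\sigma(p)})C_{q,\sigma(q)}$; $e_{n}=(\prod_{k=1}^{n-2}D_{k,\tau(k)})F_{n-1,\tau(n-1)}+\sum_{q=1}^{n-2}(\prod_{p=1}^{q-1}D_{p,\tau(p)})C_{q,\tau(q)}$; $t_j=T_{1,j}^{-1}$ ($1\le j\le n$); $f_1=E_{1,1}$; $f_j=E_{j,j}+\sum_{i=1}^{j-1}B_{i,j}$ ($2\le j\le n-1$); $f_n=E_{n-1,n}+\sum_{i=1}^{n-2}B_{i,n}$, where $C_{i,j}=\{z_{i,j-1}z_{i,j}^{-1}\}x_{i,j}+\{z_{j+1,i}z_{j,i}^{-1}\}x_{i,j-1}^{-1}x_{i,j}x_{j,i}$ ($1\le i<j\le n-2$); $C_{i,n-1}=\{z_{i,n-2}z_{i,n-1}^{-1}\}x_{i,n-1}+\{z_{i,n}z_{n-1,i}^{-1}\}x_{i,n-2}^{-1}x_{i,n-1}x_{n-1,i}$, $C_{i,n}=\{z_{i,n-2}z_{i,n}^{-1}\}x_{i,n}+\{z_{i,n-1}z_{n-1,i}^{-1}\}x_{i,n-2}^{-1}x_{i,n}x_{n-1,i}$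 ($1\le i\le n-2$); $D_{i,j}=x_{i,j-1}^{-1}x_{i,j}x_{j+1,i}^{-1}x_{j,i}$ ($1\le i<j\le n-2$), $D_{i,n-1}=x_{i,n-2}^{-1}x_{i,n-1}x_{i,n}^{-1}x_{n-1,i}$, $D_{i,n}=x_{i,n-2}^{-1}x_{i,n}x_{i,n-1}^{-1}x_{n-1,i}$ ($1\le i\le n-2$); $F_{j,j}=\{z_{j,j}^{-1}\}x_{j,j}$ ($1\le j\le n-1$), $F_{n-1,n}=\{z_{n-1,n}^{-1}\}x_{n-1,n}$; $T_{i,j}=(\prod_{k=i}^{j-1}A_{k,j})T_{j,j}$ ($1\le i<j\le n-1$), $T_{i,n}=(\prod_{k=i}^{n-2}A_{k,n})T_{n-1,n}$ ($1\le i\le n-2$); $A_{i,j}=z_{i,j-1}^{-1}z_{i,j}^2z_{i,j+1}^{-1}z_{j+2,i}^{-1}z_{j+1,i}^2z_{j,i}^{-1}$ ($1\le i<j\le n-3$), $A_{i,n-2}=z_{i,n-3}^{-1}z_{i,n-2}^2z_{i,n-1}^{-1}z_{i,n}^{-1}z_{n-1,i}^2z_{n-2,i}^{-1}$ ($1\le i<n-2$), $A_{i,n-1}=z_{i,n-2}^{-1}z_{i,n-1}^2z_{n-1,i}^{-1}$, $A_{i,n}=z_{i,n-2}^{-1}z_{i,n}^2z_{n-1,i}^{-1}$ ($1\le i\le n-2$); $T_{j,j}=z_{j,j}^2z_{j,j+1}^{-1}z_{j+2,j}^{-1}z_{j+1,j}^2z_{j+1,j+1}^{-1}z_{j+2,j+1}^{-1}\varepsilon^{\lambda_j}$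 ($1\le j\le n-3$), $T_{n-2,n-2}=z_{n-2,n-2}^2z_{n-2,n-1}^{-1}z_{n-2,n}^{-1}z_{n-1,n-2}^2z_{n-1,n-1}^{-1}z_{n-1,n}^{-1}\varepsilon^{\lambda_{n-2}}$, $T_{n-1,n-1}=z_{n-1,n-1}^2\varepsilon^{\lambda_{n-1}}$, $T_{n-1,n}=z_{n-1,n}^2\varepsilon^{\lambda_n}$; $B_{i,j}=\{z_{i,j}z_{i,j+1}^{-1}z_{j+2,i}^{-1}z_{j+1,i}^2z_{j,i}^{-1}T_{i+1,j}\}x_{i,j}^{-1}+\{z_{j+1,i}z_{j,i}^{-1}T_{i+1,j}\}x_{j+1,i}^{-1}$ ($1\le i<j\le n-3$); $B_{i,n-2}=\{z_{i,n-2}z_{i,n-1}^{-1}z_{i,n}^{-1}z_{n-1,i}^2z_{n-2,i}^{-1}T_{i+1,n-2}\}x_{i,n-2}^{-1}+\{z_{n-1,i}z_{n-2,i}^{-1}T_{i+1,n-2}\}x_{n-1,i}^{-1}$ ($1\le i<n-2$); $B_{i,n-1}=\{z_{i,n-1}z_{n-1,i}^{-1}T_{i+1,n-1}\}x_{i,n-1}^{-1}$, $B_{i,n}=\{z_{i,n}z_{n-1,i}^{-1}T_{i+1,n}\}x_{i,n}^{-1}$ ($1\le i\le n-2$); $E_{j,j}=\{z_{j,j}z_{j,j+1}^{-1}z_{j+2,j}^{-1}z_{j+1,j}^2z_{j+1,j+1}^{-1}z_{j+2,j+1}^{-1}\varepsilon^{\lambda_j}\}x_{j,j}^{-1}+\{z_{j+1,j}z_{j+1,j+1}^{-1}z_{j+2,j+1}^{-1}\varepsilon^{\lambda_j}\}x_{j+1,j}^{-1}$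 ($1\le j\le n-3$); $E_{n-2,n-2}=\{z_{n-2,n-2}z_{n-2,n-1}^{-1}z_{n-2,n}^{-1}z_{n-1,n-2}^2z_{n-1,n-1}^{-1}z_{n-1,n}^{-1}\varepsilon^{\lambda_{n-2}}\}x_{n-2,n-2}^{-1}+\{z_{n-1,n-2}z_{n-1,n-1}^{-1}z_{n-1,n}^{-1}\varepsilon^{\lambda_{n-2}}\}x_{n-1,n-2}^{-1}$; $E_{n-1,n-1}=\{z_{n-1,n-1}\varepsilon^{\lambda_{n-1}}\}x_{n-1,n-1}^{-1}$, $E_{n-1,n}=\{z_{n-1,n}\varepsilon^{\lambda_n}\}x_{n-1,n}^{-1}$. *)

(* Defs.v *)
From HB Require Import structures.
From mathcomp Require Import all_boot all_order all_algebra.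
From mathcomp Require Import complex.
From mathcomp Require Import all_reals sequences exp trigo.
Set Implicit Arguments.
Unset Strict Implicit.
Unset Printing Implicit Defensive.
Import Order.TTheory GRing.Theory Num.Theory.
Local Open Scope ring_scope.
Local Open Scope complex_scope.

Definition cexp {R : realType} (c : R[i]) : R[i] :=
  let: a +i* b := c in (expR a * cos b) +i* (expR a * sin b).

(* Subscripts i, j of m_ij, x_ij, z_ij, lambda_j, and those of the operators
   built from them, are 1-based natural numbers, as in the formulas of Schnizer;
   the underlying ordinals are 0-based. *)
Section Index.
Variables l n : nat.

(* 'Z_l is Z/lZ only for l > 1. *)
Definition mindex := 'M['Z_l]_(n.-1, n).

Definition entry (m : mindex) (i j : nat) : 'Z_l :=
  if (insub i.-1, insub j.-1) is (Some a, Some b) then m a b else 0.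

Definition unit_index (i j : nat) : mindex :=
  \matrix_(a < n.-1, b < n) ((a.+1 == i) && (b.+1 == j))%:R.

(* The truncated subtractions are exact for 1 <= i <= n-1 and 1 <= j <= n. *)
Definition bshift (i j : nat) : nat :=
  (if j == n then n - i
   else if i <= j then j.+1 - i
   else n.*2 - i - j)%N.

End Index.

(* (C^l)^{(x) n(n-1)}, in the coordinates of the basis u(m). *)
Definition schnizerV (R : realType) (l n : nat) : vectType R[i] :=
  {ffun mindex l n -> (R[i])^o}.

Definition basis_vec {R : realType} {l n : nat} (m : mindex l n) :
    schnizerV R l n :=
  [ffun m' => (m' == m)%:R].

Definition extend {R : realType} {l n : nat}
    (f : mindex l n -> schnizerV R l n) : 'End(schnizerV R l n) :=
  linfun (fun v : schnizerV R l n =>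
    \sum_m (v : {ffun mindex l n -> (R[i])^o}) m *: f m).

Lemma extendE {R : realType} {l n : nat}
    (f : mindex l n -> schnizerV R l n) (m : mindex l n) :
  extend f (basis_vec m) = f m.
Proof.
pose g (v : schnizerV R l n) :=
  \sum_m (v : {ffun mindex l n -> (R[i])^o}) m *: f m.
have gL : linear g.
  move=> a v w; rewrite /g scaler_sumr -big_split /=.
  by apply: eq_bigr => p _; rewrite !ffunE scalerDl scalerA.
pose gl : {linear schnizerV R l n -> schnizerV R l n} :=
  HB.pack g (GRing.isLinear.Build _ _ _ _ g gL).
rewrite /extend -/g (lfunE gl) /= /g (bigD1 m) //= ffunE eqxx scale1r.
by rewrite big1 ?addr0 // => p /negPf pm; rewrite ffunE pm scale0r.
Qed.

Inductive Ueps_generator (n : nat) : Type :=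
  | gen_e of 'I_n
  | gen_f of 'I_n
  | gen_t of 'I_n
  | gen_tinv of 'I_n.

Section Schnizer.
Variables (R : realType) (l n : nat).
Variables (eps logeps : R[i]) (lambda : 'I_n -> R[i]).
Local Notation V := (schnizerV R l n).
Local Open Scope lfun_scope.

Definition xop (i j : nat) : 'End(V) :=
  extend (fun m => basis_vec (m - unit_index l n i j)).

Definition zop (i j : nat) : 'End(V) :=
  extend (fun m => (eps ^+ (entry m i j + bshift n i j))%R *: basis_vec m).

Lemma xopE i j m : xop i j (basis_vec m) = basis_vec (m - unit_index l n i j).
Proof. exact: extendE. Qed.

Lemma zopE i j m :
  zop i j (basis_vec m)
  = (eps ^+ (entry m i j + bshift n i j))%R *: basis_vec m.
Proof. exact: extendE. Qed.

(* ^-1 is the inverse of a linear map; xop is invertible, and zop is when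
   eps != 0; every map inverted below is a product of such maps and scalars. *)
Local Notation "x_[ i , j ]" := (xop i j) (at level 0, i, j at level 50).
Local Notation "z_[ i , j ]" := (zop i j) (at level 0, i, j at level 50).
Local Notation "h ^2" := (comp_lfun h h) (at level 3, left associativity).
Local Notation comp_end := (@comp_lfun _ V V V).

Definition brace (h : 'End(V)) : 'End(V) :=
  ((eps - eps^-1)^-1)%R *: (h - (h^-1)%VF).

Definition eps_lambda (j : nat) : 'End(V) :=
  cexp (oapp lambda 0 (insub j.-1) * logeps) *: \1.

Definition opC (i j : nat) : 'End(V) :=
  if (j <= n - 2)%N then
    (brace (z_[i, j.-1] \o z_[i, j]^-1) \o x_[i, j])
    + (brace (z_[j.+1, i] \o z_[j, i]^-1)
         \o (x_[i, j.-1]^-1 \o x_[i, j] \o x_[j, i]))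
  else if j == n.-1 then
    (brace (z_[i, n - 2] \o z_[i, n.-1]^-1) \o x_[i, n.-1])
    + (brace (z_[i, n] \o z_[n.-1, i]^-1)
         \o (x_[i, n - 2]^-1 \o x_[i, n.-1] \o x_[n.-1, i]))
  else
    (brace (z_[i, n - 2] \o z_[i, n]^-1) \o x_[i, n])
    + (brace (z_[i, n.-1] \o z_[n.-1, i]^-1)
         \o (x_[i, n - 2]^-1 \o x_[i, n] \o x_[n.-1, i])).

Definition opD (i j : nat) : 'End(V) :=
  if (j <= n - 2)%N then
    x_[i, j.-1]^-1 \o x_[i, j] \o x_[j.+1, i]^-1 \o x_[j, i]
  else if j == n.-1 then
    x_[i, n - 2]^-1 \o x_[i, n.-1] \o x_[i, n]^-1 \o x_[n.-1, i]
  else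
    x_[i, n - 2]^-1 \o x_[i, n] \o x_[i, n.-1]^-1 \o x_[n.-1, i].

Definition opF (i j : nat) : 'End(V) := brace (z_[i, j]^-1) \o x_[i, j].

Definition opA (i j : nat) : 'End(V) :=
  if (j <= n - 3)%N then
    z_[i, j.-1]^-1 \o z_[i, j]^2 \o z_[i, j.+1]^-1
      \o z_[j.+2, i]^-1 \o z_[j.+1, i]^2 \o z_[j, i]^-1
  else if j == (n - 2)%N then
    z_[i, n - 3]^-1 \o z_[i, n - 2]^2 \o z_[i, n.-1]^-1 \o z_[i, n]^-1
      \o z_[n.-1, i]^2 \o z_[n - 2, i]^-1
  else if j == n.-1 then
    z_[i, n - 2]^-1 \o z_[i, n.-1]^2 \o z_[n.-1, i]^-1
  else
    z_[i, n - 2]^-1 \o z_[i, n]^2 \o z_[n.-1, i]^-1.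

(* The operators T_{j,j} (j < n) and, for j = n, T_{n-1,n}. *)
Definition opTlast (j : nat) : 'End(V) :=
  if (j <= n - 3)%N then
    z_[j, j]^2 \o z_[j, j.+1]^-1 \o z_[j.+2, j]^-1 \o z_[j.+1, j]^2
      \o z_[j.+1, j.+1]^-1 \o z_[j.+2, j.+1]^-1 \o eps_lambda j
  else if j == (n - 2)%N then
    z_[n - 2, n - 2]^2 \o z_[n - 2, n.-1]^-1 \o z_[n - 2, n]^-1
      \o z_[n.-1, n - 2]^2 \o z_[n.-1, n.-1]^-1 \o z_[n.-1, n]^-1
      \o eps_lambda (n - 2)
  else if j == n.-1 then z_[n.-1, n.-1]^2 \o eps_lambda n.-1
  else z_[n.-1, n]^2 \o eps_lambda n.

Definition opT (i j : nat) : 'End(V) :=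
  (\big[comp_end / \1]_(i <= k < minn j n.-1) opA k j) \o opTlast j.

Definition opB (i j : nat) : 'End(V) :=
  if (j <= n - 3)%N then
    (brace (z_[i, j] \o z_[i, j.+1]^-1 \o z_[j.+2, i]^-1 \o z_[j.+1, i]^2
              \o z_[j, i]^-1 \o opT i.+1 j) \o x_[i, j]^-1)
    + (brace (z_[j.+1, i] \o z_[j, i]^-1 \o opT i.+1 j) \o x_[j.+1, i]^-1)
  else if j == (n - 2)%N then
    (brace (z_[i, n - 2] \o z_[i, n.-1]^-1 \o z_[i, n]^-1 \o z_[n.-1, i]^2
              \o z_[n - 2, i]^-1 \o opT i.+1 (n - 2)) \o x_[i, n - 2]^-1)
    + (brace (z_[n.-1, i] \o z_[n - 2, i]^-1 \o opT i.+1 (n - 2))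
         \o x_[n.-1, i]^-1)
  else if j == n.-1 then
    brace (z_[i, n.-1] \o z_[n.-1, i]^-1 \o opT i.+1 n.-1) \o x_[i, n.-1]^-1
  else
    brace (z_[i, n] \o z_[n.-1, i]^-1 \o opT i.+1 n) \o x_[i, n]^-1.

(* The operators E_{j,j} (j < n) and, for j = n, E_{n-1,n}. *)
Definition opE (j : nat) : 'End(V) :=
  if (j <= n - 3)%N then
    (brace (z_[j, j] \o z_[j, j.+1]^-1 \o z_[j.+2, j]^-1 \o z_[j.+1, j]^2
              \o z_[j.+1, j.+1]^-1 \o z_[j.+2, j.+1]^-1 \o eps_lambda j)
       \o x_[j, j]^-1)
    + (brace (z_[j.+1, j] \o z_[j.+1, j.+1]^-1 \o z_[j.+2, j.+1]^-1
                \o eps_lambda j) \o x_[j.+1, j]^-1)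
  else if j == (n - 2)%N then
    (brace (z_[n - 2, n - 2] \o z_[n - 2, n.-1]^-1 \o z_[n - 2, n]^-1
              \o z_[n.-1, n - 2]^2 \o z_[n.-1, n.-1]^-1 \o z_[n.-1, n]^-1
              \o eps_lambda (n - 2)) \o x_[n - 2, n - 2]^-1)
    + (brace (z_[n.-1, n - 2] \o z_[n.-1, n.-1]^-1 \o z_[n.-1, n]^-1
                \o eps_lambda (n - 2)) \o x_[n.-1, n - 2]^-1)
  else if j == n.-1 then
    brace (z_[n.-1, n.-1] \o eps_lambda n.-1) \o x_[n.-1, n.-1]^-1
  else
    brace (z_[n.-1, n] \o eps_lambda n) \o x_[n.-1, n]^-1.

Definition sigma (k : nat) : nat := if odd k then n.-1 else n.
Definition tau (k : nat) : nat := if odd k then n else n.-1.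

(* The common shape of the formulas for e_j (j <= n-2), e_{n-1} and e_n:
   (prod_{k=1}^{N-1} D_{k,c(k)}) F_{N,c(N)}
   + sum_{q=1}^{N-1} (prod_{p=1}^{q-1} D_{p,c(p)}) C_{q,c(q)}. *)
Definition opEgen (N : nat) (c : nat -> nat) : 'End(V) :=
  ((\big[comp_end / \1]_(1 <= k < N) opD k (c k)) \o opF N (c N))
  + \sum_(1 <= q < N)
      ((\big[comp_end / \1]_(1 <= p < q) opD p (c p)) \o opC q (c q)).

Definition act_e (j : nat) : 'End(V) :=
  if j == 1%N then opF 1 1
  else if (j <= n - 2)%N then opEgen j (fun=> j)
  else if j == n.-1 then opEgen n.-1 sigma
  else opEgen n.-1 tau.

Definition act_f (j : nat) : 'End(V) :=
  if j == 1%N then opE 1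
  else opE j + \sum_(1 <= i < minn j n.-1) opB i j.

Definition act_t (j : nat) : 'End(V) := (opT 1 j)^-1.

(* The images of the generators of U_eps(so(2n)). That they satisfy the defining
   relations is a theorem of Schnizer, and is not used by this definition. *)
Definition schnizer_action (g : Ueps_generator n) : 'End(V) :=
  match g with
  | gen_e i => act_e i.+1
  | gen_f i => act_f i.+1
  | gen_t i => act_t i.+1
  | gen_tinv i => (act_t i.+1)^-1
  end.

End Schnizer.

(* Main.v *)
Require Import Defs.
From HB Require Import structures.
From mathcomp Require Import all_boot all_order all_algebra.
From mathcomp Require Import zify.
From mathcomp Require Import complex.
From mathcomp Require Import all_reals sequences exp trigo.
Set Implicit Arguments.
Unset Strict Implicit.
Unset Printing Implicit Defensive.
Import Order.TTheory GRing.Theory Num.Theory.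
Local Open Scope ring_scope.
Local Open Scope complex_scope.

(** Write a row of the array m as m_ii, ..., m_in and the matching column as
    m_(i+1)i, ..., m_(n-1)i. Every operator e_j is obtained by a recursion on i:
    the operator at row i is D_(i,k) e' + C_(i,k), where k = j, except that the
    two spin columns n-1 and n alternate with the parity of i, and where e', the
    operator at row i+1, does not involve the entries of row and column i. All
    the operators C_(i,k) and D_(i,k) have one shape. There are positions
    a, b, c, d with
      D = x_a^-1 x_b x_d^-1 x_c,
      C = {z_a z_b^-1} x_b + {z_d z_c^-1} x_a^-1 x_b x_c,
    where b = (i,k), a is its predecessor in row i, c is the entry of column i
    attached to k and d the next one towards the end of the column, the last d
    being a spin entry of row i. The integers b_ij are such that C sends u(m) to
    [m_a - m_b] x_b u(m) + [m_d - m_c] x_a^-1 x_b x_c u(m), and a quantum integer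
    vanishes only if its argument is 0 mod l, because l is odd. In particular
    every C, and likewise every F, kills u(0), hence so does every e_j.

    Conversely, let u be killed by all the operators at row i. First, F_ii u = 0 gives
    m_ii = 0 on the support of u. Along row i, once m_a = 0 on the support of u,
    hence on that of e'u, the first summand of C u lives on m_a = 0 while the
    second one and D e'u live on m_a = 1. So the equation splits, the first
    summand vanishes and m_b = m_a = 0 on the support (step_row). In the end the
    whole row vanishes, in particular both spin entries. The remaining equation
    D e'u + {z_d z_c^-1} x_a^-1 x_b x_c u = 0 is then split in the same way by
    m_d, walking back along the column from the spin end: m_c = m_d = 0 and
    D e'u = 0, that is e'u = 0 (step_column). So u is supported on arrays whose
    row and column i vanish, and is killed by the operators at row i+1
    (killed_descent). After n-1 rows the support is reduced to m = 0. *)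

Section SchnizerModule.
Variables (R : realType) (l n : nat) (eps : R[i]).
Hypotheses (l_gt3 : (3 < l)%N) (l_odd : odd l).
Hypothesis eps_prim : l.-primitive_root eps.

Local Notation V := (schnizerV R l n).
Local Notation index := (mindex l n).
Local Notation x_ p := (xop R l n p.1 p.2).
Local Notation z_ p := (zop l n eps p.1 p.2).
Local Notation C_ := (opC l n eps).
Local Notation D_ := (opD R l n).
Local Notation F_ := (opF l n eps).

(** The ascription to finite functions makes their application visible, which
    the vector space structure of V hides. *)
Definition coef (u : V) (m : index) : R[i] :=
  (u : {ffun index -> (R[i])^o}) m.

Lemma coefP (u v : V) : (forall m, coef u m = coef v m) -> u = v.
Proof. by move=> uv; apply/ffunP. Qed.

Lemma coef0 m : coef 0 m = 0. Proof. by rewrite /coef ffunE. Qed.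

Lemma coefD (u v : V) m : coef (u + v) m = coef u m + coef v m.
Proof. by rewrite /coef ffunE. Qed.

Lemma coefB (u v : V) m : coef (u - v) m = coef u m - coef v m.
Proof. by rewrite /coef !ffunE. Qed.

Lemma coefZ a (u : V) m : coef (a *: u) m = a * coef u m.
Proof. by rewrite /coef ffunE. Qed.

Lemma coef_basis m m' : coef (basis_vec m : V) m' = (m' == m)%:R.
Proof. by rewrite /coef ffunE. Qed.

Lemma coef_sum (I : finType) (F : I -> V) m :
  coef (\sum_i F i) m = \sum_i coef (F i) m.
Proof. exact: (big_morph (coef ^~ m) (fun u v => coefD u v m) (coef0 m)). Qed.

Lemma basis_sum (u : V) : u = \sum_m coef u m *: basis_vec m.
Proof.
apply: coefP => m; rewrite [RHS]coef_sum.
transitivity (\sum_m' coef u m' * (m == m')%:R).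
  rewrite (bigD1 m isT) /= eqxx mulr1 big1 ?addr0 // => m' neq.
  by rewrite eq_sym (negPf neq) mulr0.
by apply: eq_bigr => m' _; rewrite coefZ coef_basis.
Qed.

Lemma coef_extend (f : index -> V) u m :
  coef (extend f u) m = \sum_m' coef u m' * coef (f m') m.
Proof.
rewrite {1}[u]basis_sum linear_sum coef_sum; apply: eq_bigr => m' _.
by rewrite linearZ /= extendE coefZ.
Qed.

(** * Translations and diagonal operators *)

Definition translates (A : 'End(V)) (d : index) :=
  forall u m, coef (A u) m = coef u (m + d).

Definition scales (A : 'End(V)) (f : index -> R[i]) :=
  forall u m, coef (A u) m = f m * coef u m.

(** The inverse of a linear map is the true inverse only for an injective map;
    this is how the inverses of the x and z operators are computed. *)
Lemma lfun_inv_can (A : 'End(V)) (B : V -> V) :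
  cancel A B -> cancel B A -> forall u, (A^-1)%VF u = B u.
Proof.
move=> AK BK u; rewrite -{1}(BK u) lker0_lfunK //.
exact/lker0P/(can_inj AK).
Qed.

Lemma translates_inv A d : translates A d -> translates (A^-1)%VF (- d).
Proof.
move=> tA; pose B (u : V) : V := [ffun m => coef u (m - d)].
have coB u m : coef (B u) m = coef u (m - d) by rewrite {1}/coef ffunE.
suff AV u : (A^-1)%VF u = B u by move=> u m; rewrite AV coB.
by apply: lfun_inv_can => v; apply: coefP => m;
  rewrite ?(coB, tA) ?(coB, tA) ?addrK ?subrK.
Qed.

Lemma translates_comp A B d e : translates A d -> translates B e ->
  translates (A \o B)%VF (d + e).
Proof. by move=> tA tB u m; rewrite comp_lfunE tA tB addrA. Qed.

Lemma translates_x p : translates (x_ p) (unit_index l n p.1 p.2).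
Proof.
move=> u m; rewrite coef_extend (bigD1 (m + unit_index l n p.1 p.2)) //=.
rewrite coef_basis addrK eqxx mulr1 big1 ?addr0 // => m' neq.
rewrite coef_basis; case: eqP => [E|]; last by rewrite mulr0.
by rewrite E subrK eqxx in neq.
Qed.

Lemma translates_inj A d : translates A d -> forall u, A u = 0 -> u = 0.
Proof.
move=> tA u Au0; apply: coefP => m.
by rewrite coef0 -[m](subrK d) -tA Au0 coef0.
Qed.

Lemma scales_inv A f : (forall m, f m != 0) -> scales A f ->
  scales (A^-1)%VF (fun m => (f m)^-1).
Proof.
move=> f0 sA; pose B (u : V) : V := [ffun m => (f m)^-1 * coef u m].
have coB u m : coef (B u) m = (f m)^-1 * coef u m by rewrite {1}/coef ffunE.
suff AV u : (A^-1)%VF u = B u by move=> u m; rewrite AV coB.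
by apply: lfun_inv_can => v; apply: coefP => m;
  rewrite ?(coB, sA) ?(coB, sA) ?mulKf ?mulVKf.
Qed.

Lemma scales_comp A B f g : scales A f -> scales B g ->
  scales (A \o B)%VF (fun m => f m * g m).
Proof. by move=> sA sB u m; rewrite comp_lfunE sA sB mulrA. Qed.

(** The eigenvalue of brace h on a vector where h has eigenvalue w. *)
Definition braceS (w : R[i]) : R[i] := (eps - eps^-1)^-1 * (w - w^-1).

Lemma scales_brace A f : (forall m, f m != 0) -> scales A f ->
  scales (brace eps A) (fun m => braceS (f m)).
Proof.
move=> f0 sA u m; rewrite /brace /braceS scale_lfunE add_lfunE opp_lfunE.
by rewrite coefZ coefB sA (scales_inv f0 sA) -mulrBl mulrA.
Qed.

(** * Powers of eps indexed by residues *)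

Definition chi (a : 'Z_l) : R[i] := eps ^+ a.

Lemma l_gt1 : (1 < l)%N. Proof. by case: l l_gt3 => [|[|]]. Qed.

Lemma eps_neq0 : eps != 0.
Proof.
apply/eqP => e0; have := prim_expr_order eps_prim.
by rewrite e0 expr0n; case: l l_gt1 => //= k _ /eqP; rewrite eq_sym oner_eq0.
Qed.

Lemma chi_neq0 a : chi a != 0. Proof. by rewrite expf_neq0 ?eps_neq0. Qed.

Lemma chiD a b : chi (a + b) = chi a * chi b.
Proof.
rewrite /chi -exprD -(prim_expr_mod eps_prim (a + b)) /=.
by congr (_ ^+ (_ %% _)); rewrite Zp_cast ?l_gt1.
Qed.

Lemma chi0 : chi 0 = 1. Proof. by []. Qed.

Lemma chi1 : chi 1 = eps.
Proof. by rewrite /chi /= modn_small. Qed.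

Lemma chiB a b : chi (a - b) = chi a / chi b.
Proof.
by apply: (mulIf (chi_neq0 b)); rewrite -chiD subrK divfK ?chi_neq0.
Qed.

(** As l is odd, eps^2 is again primitive, so a power of eps equal to its inverse
    is 1. The case a = 1 also shows that eps - eps^-1 is nonzero. *)
Lemma braceS_eq0 a : (braceS (chi a) == 0) = (a == 0).
Proof.
have prim2 : l.-primitive_root (eps ^+ 2).
  by rewrite prim_root_exp_coprime // coprime2n.
have sqr1 b : (chi b == (chi b)^-1) = (b == 0).
  rewrite -(inj_eq (mulfI (chi_neq0 b))) mulfV ?chi_neq0 //.
  rewrite /chi -expr2 -exprM mulnC exprM -(prim_order_dvd prim2).
  apply/idP/eqP => [/dvdnP[k bk]|->]; last by rewrite dvdn0.
  apply: val_inj => /=; have := ltn_ord b; rewrite {2}Zp_cast ?l_gt1 // bk.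
  by case: k {bk} => [|k]; rewrite ?mul0n // mulSn ltnNge leq_addr.
rewrite /braceS mulf_eq0 invr_eq0 !subr_eq0 sqr1.
by rewrite -{1}chi1 -{1}chi1 sqr1 oner_eq0.
Qed.

(** * Supports *)

Definition at_ (m : index) (p : nat * nat) : 'Z_l := entry m p.1 p.2.

Definition inside (p : nat * nat) : bool := (0 < p.1 < n)%N && (0 < p.2 <= n)%N.

Definition supp p v (u : V) := forall m, coef u m != 0 -> at_ m p = v.

Definition keeps p (A : 'End(V)) := forall u, supp p 0 u -> supp p 0 (A u).

Lemma atD m m' p : at_ (m + m') p = at_ m p + at_ m' p.
Proof.
by rewrite /at_ /entry; case: (insub p.1.-1 : option 'I_n.-1) => [a|];
  case: (insub p.2.-1 : option 'I_n) => [b|]; rewrite ?addr0 ?mxE.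
Qed.

Lemma atN m p : at_ (- m) p = - at_ m p.
Proof.
by rewrite /at_ /entry; case: (insub p.1.-1 : option 'I_n.-1) => [a|];
  case: (insub p.2.-1 : option 'I_n) => [b|]; rewrite ?oppr0 ?mxE.
Qed.

Lemma at0 p : at_ 0 p = 0.
Proof. by rewrite /at_ /entry; case: (insub p.1.-1 : option 'I_n.-1) => [a|];
  case: (insub p.2.-1 : option 'I_n) => [b|]; rewrite ?mxE. Qed.

Lemma at_unit p q : inside q -> at_ (unit_index l n p.1 p.2) q = (p == q)%:R.
Proof.
case: p q => [p1 p2] [[|q1] [|q2]] /andP[] //= q1n q2n.
have q1n' : (q1 < n.-1)%N by rewrite ltn_predRL.
rewrite /at_ /entry /= (insubT (fun k => (k < n.-1)%N) q1n').
rewrite (insubT (fun k => (k < n)%N) q2n) mxE /= xpair_eqE.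
by rewrite !(eq_sym _.+1).
Qed.

Lemma at_eq0 (m : index) : (forall p, inside p -> at_ m p = 0) -> m = 0.
Proof.
move=> m0; apply/matrixP => i j; have := m0 (i.+1, j.+1).
rewrite /at_ /entry /= !valK mxE; apply.
by rewrite /inside /= -ltn_predRL !ltn_ord.
Qed.

(** Vectors supported on two different values of m_p are independent: this is
    what breaks one equation e_j u = 0 into several. *)
Lemma split_supp p v1 v2 (u1 u2 : V) :
  v1 != v2 -> supp p v1 u1 -> supp p v2 u2 -> u1 + u2 = 0 -> u1 = 0 /\ u2 = 0.
Proof.
move=> v12 s1 s2 sum0; suff u10 : u1 = 0 by move: sum0; rewrite u10 add0r.
apply: coefP => m; rewrite coef0; apply/eqP; apply: contraT => u1m.
have u2m : coef u2 m != 0.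
  apply: contraNneq u1m => u2m.
  by move: (coefD u1 u2 m); rewrite sum0 coef0 u2m addr0 => <-.
by rewrite -(s1 m u1m) -(s2 m u2m) eqxx in v12.
Qed.

Lemma supp_add p v u1 u2 : supp p v u1 -> supp p v u2 -> supp p v (u1 + u2).
Proof.
move=> s1 s2 m; rewrite coefD.
have [u1m|/s1 //] := eqVneq (coef u1 m) 0.
by rewrite u1m add0r => /s2.
Qed.

Lemma supp_translates A d p v u :
  translates A d -> supp p v u -> supp p (v - at_ d p) (A u).
Proof. by move=> tA s m; rewrite tA => /s <-; rewrite atD addrK. Qed.

Lemma supp_scales A f p v u : scales A f -> supp p v u -> supp p v (A u).
Proof.
by move=> sA s m; rewrite sA mulf_eq0 negb_or => /andP[_ /s].
Qed.

Lemma keeps_comp p A B : keeps p A -> keeps p B -> keeps p (A \o B)%VF.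
Proof. by move=> kA kB u s; rewrite comp_lfunE; apply/kA/kB. Qed.

Lemma keeps_add p A B : keeps p A -> keeps p B -> keeps p (A + B).
Proof.
by move=> kA kB u s; rewrite add_lfunE; apply: supp_add; [apply: kA | apply: kB].
Qed.

Lemma keeps_translates p A d : translates A d -> at_ d p = 0 -> keeps p A.
Proof. by move=> tA d0 u /(supp_translates tA); rewrite d0 subr0. Qed.

Lemma keeps_scales p A f : scales A f -> keeps p A.
Proof. by move=> sA u; apply: supp_scales. Qed.

(** * Kernels of the elementary operators *)

Lemma scales_z p :
  scales (z_ p) (fun m => chi (at_ m p) * eps ^+ bshift n p.1 p.2).
Proof.
move=> u m; rewrite coef_extend (bigD1 m) //= big1 => [|m' neq].
  rewrite addr0 coefZ coef_basis eqxx mulr1 mulrC.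
  by rewrite /chi exprD.
by rewrite coefZ coef_basis eq_sym (negPf neq) !mulr0.
Qed.

Lemma z_neq0 m p : chi (at_ m p) * eps ^+ bshift n p.1 p.2 != 0.
Proof. by rewrite mulf_neq0 ?chi_neq0 ?expf_neq0 ?eps_neq0. Qed.

Lemma scales_zV p : scales (z_ p)^-1%VF
  (fun m => (chi (at_ m p) * eps ^+ bshift n p.1 p.2)^-1).
Proof. exact: (scales_inv (z_neq0 ^~ p) (scales_z p)). Qed.

(** The translation is applied first, so at m the scalar is governed by the
    index m + d from which the coefficient comes: the vanishing condition is
    naturally one on that source index. *)
Lemma brace_kernel (h y : 'End(V)) (d : index) (g : index -> 'Z_l) u :
    scales h (fun m => chi (g (m + d))) -> translates y d ->
  (brace eps h \o y)%VF u = 0 <-> forall m, coef u m != 0 -> g m = 0.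
Proof.
move=> sh ty; have sb := scales_brace (fun m => chi_neq0 (g (m + d))) sh.
split=> [bu0 m um | g0].
  move/(congr1 (coef ^~ (m - d))): bu0; rewrite comp_lfunE sb ty coef0 subrK.
  by move/eqP; rewrite mulf_eq0 (negPf um) orbF braceS_eq0 => /eqP.
apply: coefP => m; rewrite comp_lfunE sb ty coef0.
have [->|/g0 gm] := eqVneq (coef u (m + d)) 0; first by rewrite mulr0.
by apply/eqP; rewrite mulf_eq0 braceS_eq0 gm eqxx.
Qed.

Definition brace_ratio p q : 'End(V) := brace eps (z_ p \o (z_ q)^-1)%VF.

(** The offset 1 between the shifts b_q and b_p exactly compensates the unit by
    which the translation moves m_q, so that the condition is homogeneous. *)
Lemma ratio_kernel p q y d u :
    bshift n q.1 q.2 = (bshift n p.1 p.2).+1 ->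
    at_ d p = 0 -> at_ d q = 1 -> translates y d ->
  (brace_ratio p q \o y)%VF u = 0 <->
    forall m, coef u m != 0 -> at_ m p = at_ m q.
Proof.
move=> bq dp dq ty.
have sr : scales (z_ p \o (z_ q)^-1)%VF
                 (fun m => chi (at_ (m + d) p - at_ (m + d) q)).
  move=> v m; rewrite (scales_comp (scales_z p) (scales_zV q)).
  congr (_ * _); rewrite !atD dp dq addr0 chiB chiD chi1 bq exprS !invfM.
  rewrite -!mulrA; congr (_ * _); rewrite mulrCA; congr (_ * _).
  rewrite mulrCA divff ?mulr1 //.
  by rewrite expf_neq0 ?eps_neq0.
have := brace_kernel (g := fun m => at_ m p - at_ m q) u sr ty.
rewrite /brace_ratio => ->; split=> H m um; last by rewrite H ?subrr.
by apply/eqP; rewrite -subr_eq0 H.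
Qed.

Lemma F_kernel p u : inside p -> bshift n p.1 p.2 = 1%N ->
  F_ p.1 p.2 u = 0 <-> supp p 0 u.
Proof.
move=> ip bp; have sr : scales (z_ p)^-1%VF
    (fun m => chi (- at_ (m + unit_index l n p.1 p.2) p)).
  move=> v m; rewrite (scales_zV p) bp expr1 atD at_unit // eqxx.
  by rewrite -[- _]add0r chiB chiD chi1 chi0 mul1r.
have := brace_kernel (g := fun m => - at_ m p) u sr (translates_x p).
rewrite /opF => ->; split=> H m um; last by rewrite H ?oppr0.
by rewrite -[at_ m p]opprK H ?oppr0.
Qed.

(** * One step of the recursion *)

Definition stepD (a b c d : nat * nat) : 'End(V) :=
  ((x_ a)^-1 \o x_ b \o (x_ d)^-1 \o x_ c)%VF.

Definition shiftC (a b c : nat * nat) : 'End(V) :=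
  ((x_ a)^-1 \o x_ b \o x_ c)%VF.

Definition stepC (a b c d : nat * nat) : 'End(V) :=
  ((brace_ratio a b \o x_ b) + (brace_ratio d c \o shiftC a b c))%VF.

(** The constraints on the shifts b_ij are those that make both braces of stepC
    vanish exactly on equal entries. *)
Definition step_pos (a b c d : nat * nat) :=
  [/\ [&& inside a, inside b, inside c & inside d], uniq [:: a; b; c; d],
      bshift n b.1 b.2 = (bshift n a.1 a.2).+1
    & bshift n c.1 c.2 = (bshift n d.1 d.2).+1].

Local Notation unit_ p := (unit_index l n p.1 p.2).

Lemma translates_stepD a b c d :
  translates (stepD a b c d) (- unit_ a + unit_ b - unit_ d + unit_ c).
Proof.
by do !apply: translates_comp; try apply: translates_inv; apply: translates_x.
Qed.

Lemma translates_shiftC a b c :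
  translates (shiftC a b c) (- unit_ a + unit_ b + unit_ c).
Proof.
by do !apply: translates_comp; try apply: translates_inv; apply: translates_x.
Qed.

Lemma scales_ratio p q : exists f, scales (brace_ratio p q) f.
Proof.
eexists; apply: scales_brace; last exact: (scales_comp (scales_z p) (scales_zV q)).
by move=> m; rewrite mulf_neq0 ?invr_neq0 ?z_neq0.
Qed.

Lemma keeps_ratio p q r : keeps r (brace_ratio p q).
Proof. by have [f] := scales_ratio p q; apply: keeps_scales. Qed.

Section Step.
Variables (a b c d : nat * nat).
Hypothesis pos : step_pos a b c d.

Let neqs : [/\ ((a == b) = false) * ((b == a) = false),
  ((a == c) = false) * ((c == a) = false),
  ((a == d) = false) * ((d == a) = false),
  ((b == c) = false) * ((c == b) = false)
  & (((b == d) = false) * ((d == b) = false))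
    * (((c == d) = false) * ((d == c) = false))].
Proof.
case: pos => _; rewrite /= !inE !negb_or !andbT.
case/and3P=> /and3P[/negPf ab /negPf ac /negPf ad] /andP[/negPf bc /negPf bd].
by move=> /negPf cd _ _; do !split; rewrite // eq_sym.
Qed.

Let C1_kernel u : (brace_ratio a b \o x_ b)%VF u = 0 <->
  forall m, coef u m != 0 -> at_ m a = at_ m b.
Proof.
have [/and4P[ia ib ic id] _ bb _] := pos; have [ab ac ad bc [bd cd]] := neqs.
by apply: ratio_kernel (translates_x b) => //; rewrite at_unit // ?ab ?eqxx.
Qed.

Let C2_kernel u : (brace_ratio d c \o shiftC a b c)%VF u = 0 <->
  forall m, coef u m != 0 -> at_ m d = at_ m c.
Proof.
have [/and4P[ia ib ic id] _ _ bc'] := pos; have [ab ac ad bc [bd cd]] := neqs.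
apply: ratio_kernel (translates_shiftC a b c) => //;
  rewrite !(atD, atN) !at_unit // ?(ab, ac, ad, bc, bd, cd, eqxx) /=;
  by rewrite ?oppr0 ?add0r.
Qed.

Lemma stepC_eq0 u :
  supp a 0 u -> supp b 0 u -> supp c 0 u -> supp d 0 u -> stepC a b c d u = 0.
Proof.
move=> sa sb sc sd; rewrite /stepC add_lfunE (proj2 (C1_kernel u)).
  by rewrite (proj2 (C2_kernel u)) ?addr0 // => m um; rewrite sd ?sc.
by move=> m um; rewrite sa ?sb.
Qed.

Let at_D : at_ (- unit_ a + unit_ b - unit_ d + unit_ c) a = -1 /\
           at_ (- unit_ a + unit_ b - unit_ d + unit_ c) d = -1.
Proof.
have [/and4P[ia ib ic id] _ _ _] := pos; have [ab ac ad bc [bd cd]] := neqs.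
rewrite !atD !atN !(at_unit _ ia) !(at_unit _ id) !(ab, ac, ad, bd, cd, eqxx).
by rewrite oppr0 !addr0 !add0r.
Qed.

Let at_C2 : at_ (- unit_ a + unit_ b + unit_ c) a = -1 /\
            at_ (- unit_ a + unit_ b + unit_ c) d = 0.
Proof.
have [/and4P[ia ib ic id] _ _ _] := pos; have [ab ac ad bc [bd cd]] := neqs.
rewrite !atD !atN !(at_unit _ ia) !(at_unit _ id) !(ab, ac, ad, bd, cd, eqxx).
by rewrite oppr0 !addr0.
Qed.

(** Translating by x_a^-1 raises m_a from 0 to 1, in D w and in the second summand
    of C u, but not in the first summand, which must therefore vanish alone. *)
Lemma step_row u w : supp a 0 u -> supp a 0 w ->
    stepD a b c d w + stepC a b c d u = 0 ->
  supp b 0 u /\ stepD a b c d w + (brace_ratio d c \o shiftC a b c)%VF u = 0.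
Proof.
move=> su sw; rewrite /stepC add_lfunE addrCA => sum0.
have [/and4P[ia _ _ _] _ _ _] := pos; have [ab _ _ _ _] := neqs.
have s1 : supp a 0 ((brace_ratio a b \o x_ b)%VF u).
  apply: keeps_comp su; first exact: keeps_ratio.
  by apply: keeps_translates (translates_x b) _; rewrite at_unit ?ab.
have sC2 : supp a 1 ((brace_ratio d c \o shiftC a b c)%VF u).
  rewrite comp_lfunE; have [f sf] := scales_ratio d c; apply: (supp_scales sf).
  move: (supp_translates (translates_shiftC a b c) su).
  by rewrite (proj1 at_C2) sub0r opprK.
have sD : supp a 1 (stepD a b c d w).
  move: (supp_translates (translates_stepD a b c d) sw).
  by rewrite (proj1 at_D) sub0r opprK.
have [|C10 D_C2] := split_supp _ s1 (supp_add sD sC2) sum0.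
  by rewrite eq_sym oner_eq0.
split; last exact: D_C2.
by move=> m um; rewrite -(su m um) (proj1 (C1_kernel u) C10 m um).
Qed.

(** Here it is x_d^-1, present in D only, that separates the two terms. *)
Lemma step_column u w : supp d 0 u -> supp d 0 w ->
    stepD a b c d w + (brace_ratio d c \o shiftC a b c)%VF u = 0 ->
  supp c 0 u /\ w = 0.
Proof.
move=> su sw sum0.
have sC2 : supp d 0 ((brace_ratio d c \o shiftC a b c)%VF u).
  apply: keeps_comp su; first exact: keeps_ratio.
  exact: keeps_translates (translates_shiftC a b c) (proj2 at_C2).
have sD : supp d 1 (stepD a b c d w).
  move: (supp_translates (translates_stepD a b c d) sw).
  by rewrite (proj2 at_D) sub0r opprK.
have [|D0 C20] := split_supp _ sD sC2 sum0; first by rewrite oner_eq0.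
split; last exact: translates_inj (translates_stepD a b c d) _ D0.
by move=> m um; rewrite -(su m um) (proj1 (C2_kernel u) C20 m um).
Qed.

End Step.

Lemma keeps_x p q : inside q -> p != q -> keeps q (x_ p) /\ keeps q (x_ p)^-1%VF.
Proof.
move=> iq /negPf pq; split.
  by apply: keeps_translates (translates_x p) _; rewrite at_unit ?pq.
apply: keeps_translates (translates_inv (translates_x p)) _.
by rewrite atN at_unit ?pq ?oppr0.
Qed.

Lemma keeps_step a b c d q : inside q -> q \notin [:: a; b; c; d] ->
  keeps q (stepD a b c d) /\ keeps q (stepC a b c d).
Proof.
move=> iq; rewrite !inE !negb_or ![q == _]eq_sym => /and4P[qa qb qc qd].
have [[ka kaV] [kb _]] := (keeps_x iq qa, keeps_x iq qb).
have [[kc _] [_ kdV]] := (keeps_x iq qc, keeps_x iq qd).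
split; first exact: keeps_comp (keeps_comp (keeps_comp kaV kb) kdV) kc.
apply: keeps_add; first exact: keeps_comp (@keeps_ratio _ _ _) kb.
exact: keeps_comp (@keeps_ratio _ _ _) (keeps_comp (keeps_comp kaV kb) kc).
Qed.

Lemma keeps_F i j q : inside q -> (i, j) != q -> keeps q (F_ i j).
Proof.
move=> iq /(keeps_x iq)[kx _]; apply: keeps_comp kx.
apply: keeps_scales (scales_brace _ (scales_zV (i, j))) => m.
exact/invr_neq0/z_neq0.
Qed.

(** * Peeling off rows and columns *)

Local Notation comp_end := (@comp_lfun _ V V V).

(** The part of the formula for e_j that involves the rows i, ..., N only. *)
Definition tail_e (i N : nat) (c : nat -> nat) : 'End(V) :=
  (\big[comp_end / \1%VF]_(i <= k < N) D_ k (c k) \o F_ N (c N))%VF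
  + \sum_(i <= q < N) (\big[comp_end / \1%VF]_(i <= p < q) D_ p (c p)
                         \o C_ q (c q))%VF.

Lemma tail_e_last N c : tail_e N N c = F_ N (c N).
Proof. by rewrite /tail_e !big_geq // comp_lfun1l addr0. Qed.

Lemma tail_e_step i N c u : (i < N)%N ->
  tail_e i N c u = D_ i (c i) (tail_e i.+1 N c u) + C_ i (c i) u.
Proof.
move=> iN; rewrite /tail_e big_ltn // [in X in _ + X]big_ltn //.
rewrite [in X in _ + (X + _)]big_geq // comp_lfun1l.
rewrite !add_lfunE !sum_lfunE !comp_lfunE linearD linear_sum /= -addrA.
congr (_ + _); rewrite addrC; congr (_ + _).
apply: eq_big_nat => q /andP[iq _].
by rewrite big_ltn // !comp_lfunE.
Qed.

Hypothesis n_ge4 : (4 <= n)%N.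

(** The number of rows involved in e_j. *)
Definition height (j : nat) : nat := minn j n.-1.

(** The column k visited by e_j in each row. *)
Definition chain (j : nat) : nat -> nat :=
  if (j <= n - 2)%N then fun=> j else if j == n.-1 then sigma n else tau n.

Definition lowered (i j : nat) : 'End(V) := tail_e i (height j) (chain j).

Lemma act_eE j : (0 < j <= n)%N -> act_e l n eps j = lowered 1 j.
Proof.
move=> /andP[j0 jn]; rewrite /act_e /lowered /height /chain.
have [->|j1] := eqVneq j 1%N.
  rewrite (_ : (1 <= n - 2)%N = true); last by lia.
  by rewrite (_ : minn 1 n.-1 = 1%N) ?tail_e_last //; lia.
case: leqP => jn2; first by rewrite (_ : minn j n.-1 = j) //; lia.
by rewrite (_ : minn j n.-1 = n.-1); [case: ifP | lia].
Qed.

(** In each row the columns are only permuted, by an involution, so there is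
    exactly one operator e_j that visits a given column. *)
Lemma chainK i j : (i <= n)%N -> (j <= n)%N -> chain (chain j i) i = j.
Proof.
move=> i_n j_n; rewrite {2}/chain; case: (leqP j (n - 2)) => jn2.
  by rewrite /chain jn2.
have h1 : (n.-1 <= n - 2)%N = false by lia.
have h2 : (n <= n - 2)%N = false by lia.
have h3 : (n == n.-1) = false by lia.
rewrite /sigma /tau; case: (eqVneq j n.-1) => jn; case odd_i: (odd i);
  rewrite /chain ?h1 ?h2 ?h3 ?eqxx /sigma /tau odd_i //; lia.
Qed.

Lemma chain_small i j : (j <= n - 2)%N -> chain j i = j.
Proof. by rewrite /chain => ->. Qed.

Lemma chain_big i j : (n - 2 < j <= n)%N -> (n - 2 < chain j i <= n)%N.
Proof.
move=> jn; rewrite /chain ifN; last by lia.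
by rewrite /sigma /tau; case: (j == n.-1); case: (odd i); lia.
Qed.

Lemma chain_range i j : (i <= n - 2)%N -> (i < j <= n)%N -> (i < chain j i <= n)%N.
Proof.
move=> i_n ij; case: (leqP j (n - 2)) => jn; first by rewrite chain_small.
by have := @chain_big i j; lia.
Qed.

(** The positions a, c, d of a step at (i, j), with b = (i, j): for j = n both the
    predecessor in the row and the entry of the column are those of n-1, and d is
    for each of the columns n-1 and n the other spin entry of the row. *)
Definition posA (i j : nat) : nat * nat := (i, minn j.-1 (n - 2)).
Definition posC (i j : nat) : nat * nat := (minn j n.-1, i).
Definition posD (i j : nat) : nat * nat :=
  if (j <= n - 2)%N then (j.+1, i) else if j == n.-1 then (i, n) else (i, n.-1).

Lemma bshift_row i j : (i <= j < n)%N -> bshift n i j = (j.+1 - i)%N.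
Proof. by move=> ij; rewrite /bshift ifN ?ifT; lia. Qed.

Lemma bshift_last i : bshift n i n = (n - i)%N.
Proof. by rewrite /bshift eqxx. Qed.

Lemma bshift_column i j : (j < i < n)%N -> bshift n i j = (n.*2 - i - j)%N.
Proof. by move=> ij; rewrite /bshift !ifN; lia. Qed.

Lemma step_posP i j : (0 < i <= n - 2)%N -> (i < j <= n)%N ->
  step_pos (posA i j) (i, j) (posC i j) (posD i j).
Proof.
move=> i_n ij; rewrite /posA /posC /posD.
have [jn2|jn2] := leqP j (n - 2).
  rewrite (_ : minn j.-1 (n - 2) = j.-1); last by lia.
  rewrite (_ : minn j n.-1 = j); last by lia.
  split; rewrite /inside /= ?inE ?xpair_eqE; try lia.
    by rewrite !bshift_row; lia.
  by rewrite !bshift_column; lia.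
rewrite (_ : minn j.-1 (n - 2) = n - 2)%N; last by lia.
rewrite (_ : minn j n.-1 = n.-1)%N; last by lia.
have [->|jn1] := eqVneq j n.-1.
  split; rewrite /inside /= ?inE ?xpair_eqE; try lia.
    by rewrite !bshift_row; lia.
  by rewrite bshift_last bshift_column; lia.
have -> : j = n by lia.
split; rewrite /inside /= ?inE ?xpair_eqE; try lia.
  by rewrite bshift_last bshift_row; lia.
by rewrite bshift_column ?bshift_row; lia.
Qed.

Lemma opD_step i j : (0 < i <= n - 2)%N -> (i < j <= n)%N ->
  D_ i j = stepD (posA i j) (i, j) (posC i j) (posD i j).
Proof.
move=> i_n ij; rewrite /opD /stepD /posA /posC /posD.
case: (leqP j (n - 2)) => jn2 /=.
  rewrite (_ : minn j.-1 (n - 2) = j.-1); last by lia.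
  by rewrite (_ : minn j n.-1 = j) //; lia.
rewrite (_ : minn j.-1 (n - 2) = n - 2)%N; last by lia.
rewrite (_ : minn j n.-1 = n.-1)%N; last by lia.
case: (eqVneq j n.-1) => [-> //|jn1].
by rewrite (_ : j = n) //; lia.
Qed.

Lemma opC_step i j : (0 < i <= n - 2)%N -> (i < j <= n)%N ->
  C_ i j = stepC (posA i j) (i, j) (posC i j) (posD i j).
Proof.
move=> i_n ij; rewrite /opC /stepC /brace_ratio /shiftC /posA /posC /posD.
case: (leqP j (n - 2)) => jn2 /=.
  rewrite (_ : minn j.-1 (n - 2) = j.-1); last by lia.
  by rewrite (_ : minn j n.-1 = j) //; lia.
rewrite (_ : minn j.-1 (n - 2) = n - 2)%N; last by lia.
rewrite (_ : minn j n.-1 = n.-1)%N; last by lia.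
case: (eqVneq j n.-1) => [-> //|jn1].
by rewrite (_ : j = n) //; lia.
Qed.

Definition last_col (j : nat) := chain j (height j).

Lemma last_col_pos j : (0 < j <= n)%N ->
  [/\ inside (height j, last_col j), bshift n (height j) (last_col j) = 1%N
    & (height j <= last_col j)%N].
Proof.
move=> jn; rewrite /last_col /height /inside.
have [jn2|jn2] := leqP j (n - 2).
  rewrite chain_small // (_ : minn j n.-1 = j); last by lia.
  by split; rewrite ?bshift_row /=; lia.
rewrite (_ : minn j n.-1 = n.-1); last by lia.
have := @chain_big n.-1 j; move: (chain _ _) => k kn /=.
have [->|kn1] := eqVneq k n; first by split; rewrite ?bshift_last; lia.
by split; rewrite ?bshift_row; lia.
Qed.

Lemma lowered_last_kernel j u : (0 < j <= n)%N ->
  lowered (height j) j u = 0 <-> supp (height j, last_col j) 0 u.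
Proof.
move=> jn; rewrite /lowered tail_e_last; have [? ? _] := last_col_pos jn.
exact: (@F_kernel (height j, last_col j)).
Qed.

Lemma lowered_step i j k u :
    (0 < i <= n - 2)%N -> (i < j <= n)%N -> chain j i = k ->
  lowered i j u = stepD (posA i k) (i, k) (posC i k) (posD i k) (lowered i.+1 j u)
                  + stepC (posA i k) (i, k) (posC i k) (posD i k) u.
Proof.
move=> i_n ij <-; have kn := @chain_range i j (proj2 (andP i_n)) ij.
rewrite -(opD_step i_n kn) -(opC_step i_n kn) /lowered.
by apply: tail_e_step; rewrite /height; lia.
Qed.

(** Descending induction on the row, from the last row of e_j. *)
Lemma height_ind (P : nat -> Prop) j :
    P (height j) -> (forall i, (0 < i < height j)%N -> P i.+1 -> P i) ->
  forall i, (0 < i <= height j)%N -> P i.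
Proof.
move=> P0 PS i; have [k] := ubnP (height j - i).
elim: k i => // k IHk i ki ij.
have [-> //|ih] := eqVneq i (height j).
by apply: PS; [|apply: IHk]; lia.
Qed.

Lemma lowered_eq0 i j u : (0 < i <= height j)%N -> (j <= n)%N ->
  (forall p, inside p -> supp p 0 u) -> lowered i j u = 0.
Proof.
move=> ij jn u0; have j0 : (0 < j <= n)%N by move: ij; rewrite /height; lia.
move: i ij; apply: height_ind => [|i ij IHi].
  by apply/lowered_last_kernel => //; apply: u0; case: (last_col_pos j0).
have i_n : (0 < i <= n - 2)%N by move: ij; rewrite /height; lia.
have ij' : (i < j <= n)%N by move: ij; rewrite /height; lia.
have pos := step_posP i_n (@chain_range i j (proj2 (andP i_n)) ij').
have [/and4P[ia ib ic id] _ _ _] := pos.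
rewrite (lowered_step u i_n ij' erefl) IHi linear0 add0r.
by apply: (stepC_eq0 pos); apply: u0.
Qed.

Lemma step_pos_min i j p : (0 < i <= n - 2)%N -> (i < j <= n)%N ->
  p \in [:: posA i j; (i, j); posC i j; posD i j] -> (i <= minn p.1 p.2)%N.
Proof.
move=> i_n ij; rewrite !inE /posA /posC /posD.
by case/or4P=> /eqP-> /=; do ?case: ifP => _ /=; lia.
Qed.

(** Both indices of every position used from row i on are at least i. *)
Lemma keeps_lowered i j p : (0 < i <= height j)%N -> (j <= n)%N ->
  inside p -> (minn p.1 p.2 < i)%N -> keeps p (lowered i j).
Proof.
move=> ij jn ip; have j0 : (0 < j <= n)%N by move: ij; rewrite /height; lia.
move: i ij; apply: height_ind => [|i ij IHi] pi.
  rewrite /lowered tail_e_last; apply: keeps_F => //; apply/eqP => pj.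
  by move: pi (last_col_pos j0) => /[swap] -[_ _]; rewrite -pj /last_col /=; lia.
have i_n : (0 < i <= n - 2)%N by move: ij; rewrite /height; lia.
have ij' : (i < j <= n)%N by move: ij; rewrite /height; lia.
have kn := @chain_range i j (proj2 (andP i_n)) ij'.
have notin : p \notin [:: posA i (chain j i); (i, chain j i);
                        posC i (chain j i); posD i (chain j i)].
  by apply/negP => /(step_pos_min i_n kn); rewrite leqNgt pi.
have [kD kC] := keeps_step ip notin.
move=> u su; rewrite (lowered_step u i_n ij' erefl).
by apply: supp_add; [apply: kD; apply: IHi; [lia|] | apply: kC].
Qed.

Definition killed i u := forall j, (i <= j <= n)%N -> lowered i j u = 0.

(** Peels off row i and column i: the row is treated in ascending order, then the
    column in descending order, as each step needs the entry a or d to vanish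
    already. *)
Lemma killed_descent i u : (0 < i <= n - 2)%N -> killed i u ->
  [/\ forall j, (i <= j <= n)%N -> supp (i, j) 0 u,
      forall j, (i < j < n)%N -> supp (j, i) 0 u
    & killed i.+1 u].
Proof.
move=> i_n ku; have i_n2 := proj2 (andP i_n).
pose w k := lowered i.+1 (chain k i) u.
have chK k : (i < k <= n)%N -> chain (chain k i) i = k.
  by move=> ik; apply: chainK; lia.
have step k : (i < k <= n)%N ->
    stepD (posA i k) (i, k) (posC i k) (posD i k) (w k)
    + stepC (posA i k) (i, k) (posC i k) (posD i k) u = 0.
  move=> ik; have kn := chain_range i_n2 ik.
  rewrite -(lowered_step u i_n kn (chK k ik)); apply: ku; lia.
have keep p k : inside p -> (minn p.1 p.2 <= i)%N -> (i < k <= n)%N ->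
    supp p 0 u -> supp p 0 (w k).
  move=> ip pi ik; have kn := chain_range i_n2 ik.
  by apply: keeps_lowered => //; rewrite /height; lia.
have row j : (i <= j <= n)%N -> supp (i, j) 0 u.
  have [k] := ubnP j; elim: k j => // k IHk j jk ij.
  have [eij|nij] := eqVneq j i.
    (* The diagonal entry is reached by e_i, whose last row is i. *)
    have i0n : (0 < i <= n)%N by lia.
    have hi : height i = i by rewrite /height; lia.
    have := proj1 (lowered_last_kernel u i0n).
    by rewrite /last_col hi chain_small // eij; apply; apply: ku; lia.
  have ij' : (i < j <= n)%N by lia.
  have pos := step_posP i_n ij'; have [/and4P[ia _ _ _] _ _ _] := pos.
  have sa : supp (posA i j) 0 u by apply: IHk; lia.
  have pa : (minn (posA i j).1 (posA i j).2 <= i)%N by rewrite /posA /=; lia.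
  exact: (proj1 (step_row pos sa (keep _ _ ia pa ij' sa) (step j ij'))).
have column k : (i < k <= n)%N -> supp (posC i k) 0 u /\ w k = 0.
  have [r] := ubnP (n - k); elim: r k => // r IHr k kr ik.
  have pos := step_posP i_n ik; have [/and4P[ia ib ic id] _ _ _] := pos.
  have sa : supp (posA i k) 0 u by apply: row; lia.
  have pa : (minn (posA i k).1 (posA i k).2 <= i)%N by rewrite /posA /=; lia.
  have sd : supp (posD i k) 0 u.
    (* Position d is the c of the next step, or a spin entry of row i. *)
    rewrite /posD; have [k2|k2] := leqP k (n - 2).
      have -> : k.+1 = minn k.+1 n.-1 by lia.
      by apply: (proj1 (IHr k.+1 _ _)); lia.
    by case: ifP => _; apply: row; lia.
  have pd : (minn (posD i k).1 (posD i k).2 <= i)%N.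
    by rewrite /posD; do ?case: ifP => _ /=; lia.
  have [_ sum0] := step_row pos sa (keep _ _ ia pa ik sa) (step k ik).
  exact (step_column pos sd (keep _ _ id pd ik sd) sum0).
split=> [//|j ij|j ij].
  have -> : j = minn j n.-1 by lia.
  by apply: (proj1 (column j _)); lia.
have kn := @chain_range i j i_n2 ij.
by have [_] := column _ kn; rewrite /w (chK j ij).
Qed.

Lemma killed_supp u p : killed 1 u -> inside p -> supp p 0 u.
Proof.
move=> k1.
have killed_all i : (0 < i <= n.-1)%N -> killed i u.
  elim: i => // -[|i] IHi i_n //.
  have i_n' : (0 < i.+1 <= n - 2)%N by lia.
  have ki : killed i.+1 u by apply: IHi; lia.
  by have [_ _] := killed_descent i_n' ki.
have row i j : (0 < i <= j)%N -> (i < n)%N -> (j <= n)%N -> supp (i, j) 0 u.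
  move=> ij i_n jn; have ki : killed i u by apply: killed_all; lia.
  have [i_n2|i_n2] := leqP i (n - 2).
    have i_n' : (0 < i <= n - 2)%N by lia.
    by have [row _ _] := killed_descent i_n' ki; apply: row; lia.
  (* In row n-1 only the two spin operators are left, both reduced to F. *)
  have jn2 : (n - 2 < j <= n)%N by lia.
  have cn := chain_big i jn2.
  have j0 : (0 < chain j i <= n)%N by lia.
  have hi : height (chain j i) = i by rewrite /height; lia.
  have ek : chain (chain j i) i = j by apply: chainK; lia.
  have := proj1 (lowered_last_kernel u j0); rewrite /last_col hi ek.
  by apply; apply: ki; lia.
case: p => i j /andP[/= i_n j_n]; have [ij|ji] := leqP i j.
  by apply: row; lia.
have j_n' : (0 < j <= n - 2)%N by lia.
have kj : killed j u by apply: killed_all; lia.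
by have [_ column _] := killed_descent j_n' kj; apply: column; lia.
Qed.

Lemma killed_iff_basis u : killed 1 u <-> exists c, u = c *: basis_vec (0 : index).
Proof.
split=> [k1|[c ->] j jn].
  exists (coef u 0); apply: coefP => m; rewrite coefZ coef_basis.
  have [-> | m0] := eqVneq m 0; first by rewrite mulr1.
  rewrite mulr0; apply: contra_neq_eq m0 => um; apply: at_eq0 => p ip.
  exact: killed_supp um.
apply: lowered_eq0; [by rewrite /height; lia | by lia |].
move=> p ip m; rewrite coefZ coef_basis.
by have [->|_] := eqVneq m 0; [rewrite at0 | rewrite mulr0 eqxx].
Qed.

End SchnizerModule.

Theorem proposition3p11 (R : realType) (l n : nat) (eps logeps : R[i])
    (lambda : 'I_n -> R[i])
    (l_gt3 : (3 < l)%N) (l_odd : odd l)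
    (eps_prim : l.-primitive_root eps) (logepsP : cexp logeps = eps)
    (n_ge4 : (4 <= n)%N) (u : schnizerV R l n) :
  (forall i : 'I_n, schnizer_action l eps logeps lambda (gen_e i) u = 0) <->
  (exists c : R[i], u = c *: basis_vec (0 : mindex l n)).
Proof.
rewrite -(killed_iff_basis l_gt3 l_odd eps_prim n_ge4 u).
split=> [eu [//|j] jn | ku i]; last first.
  by rewrite /= act_eE // ?ltn_ord //; apply: ku; rewrite /= ltn_ord.
by rewrite -act_eE //; apply: (eu (Ordinal jn)).
Qed.
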